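(* Let $\sigma$ be a connection on $B(\mathcal{H})^+$ with representing function $f$. Then the following statements are equivalent: (1) $\sigma$ is a mean; (2) $\sigma$ satisfies the betweenness property, i.e. for all $A,B\geq 0$, $A\leq B\implies A\leq A\,\sigma\,B\leq B$; (3) for all $A\geq 0$, $A\leq I\implies A\leq A\,\sigma\,I\leq I$; (4) for all $A\geq 0$, $I\leq A\implies I\leq I\,\sigma\,A\leq A$; (5) for all real $t\geq 0$, $1\leq t\implies 1\leq f(t)\leq t$; (6) for all real $t\geq 0$, $t\leq 1\implies t\leq f(t)\leq 1$; (7) for all $A,B\geq 0$, $A\leq B\implies \lVert A\rVert\leq\lVert A\,\sigma\,B\rVert\leq\lVert B\rVert$; (8) for all $A\geq 0$, $A\leq I\implies \lVert A\rVert\leq\lVert A\,\sigma\,I\rVert\leq 1$; (9) for all $A\geq 0$, $I\leq A\implies 1\leq\lVert I\,\sigma\,A\rVert\leq\lVert A\rVert$; (10) the only solution $X>0$ to the equation $X\,\sigma\,X=I$ is $X=I$ (that is, $X=I$ is a solution and there is no other solution $X>0$); (11) for all $A>0$, the only solution $X>0$ to the equation $X\,\sigma\,X=A$ is $X=A$ (that is, $X=A$ is a solution and there is no other solution $X>0$).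
   Context: $\mathcal{H}$ is a Hilbert space, $B(\mathcal{H})$ is the algebra of bounded linear operators on $\mathcal{H}$ with operator norm $\lVert\cdot\rVert$, $B(\mathcal{H})^+$ is the set of positive (i.e. positive semidefinite) operators, and $I$ is the identity operator. For Hermitian $A,B$, $A\leq B$ means $B-A\in B(\mathcal{H})^+$; $A\geq 0$ means $A\in B(\mathcal{H})^+$; $A>0$ means that $A$ is strictly positive, i.e. positive and invertible. $\mathbb{R}^+=[0,\infty)$. A connection is a binary operation $\sigma$ on $B(\mathcal{H})^+$ such that for all positive operators $A,B,C,D$: (M1) $A\leq C$, $B\leq D$ imply $A\,\sigma\,B\leq C\,\sigma\,D$; (M2) $C(A\,\sigma\,B)C\leq (CAC)\,\sigma\,(CBC)$; (M3) if $A_n,B_n\in B(\mathcal{H})^+$, $A_n\downarrow A$ and $B_n\downarrow B$, then $A_n\,\sigma\,B_n\downarrow A\,\sigma\,B$, where $A_n\downarrow A$ means that $(A_n)$ is a decreasing sequence converging strongly to $A$. A mean is a connection $\sigma$ with $A\,\sigma\,A=A$ for all $A\geq 0$. A continuous function $f:\mathbb{R}^+\to\mathbb{R}^+$ is operator monotone if $A\leq B\implies f(A)\leq f(B)$ for all positive operators $A,B$ on any Hilbert space. Standing facts assumed about $\mathcal{H}$ (Kubo–Ando correspondence; it holds for example when $\mathcal{H}$ is infinite-dimensional): for every connection $\sigma$ on $B(\mathcal{H})^+$ there is a unique operator monotone function $f:\mathbb{R}^+\to\mathbb{R}^+$, called the representing function of $\sigma$, with $f(x)I=I\,\sigma\,(xI)$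 for all $x\geq 0$, and $\sigma\mapsto f$ is a bijection from connections onto operator monotone functions $\mathbb{R}^+\to\mathbb{R}^+$. *)

(* Defs.v *)
From HB Require Import structures.
From mathcomp Require Import all_boot all_order all_algebra.
From mathcomp Require Import complex.
From mathcomp Require Import all_classical all_reals all_analysis.

Set Implicit Arguments.
Unset Strict Implicit.
Unset Printing Implicit Defensive.

Import Order.TTheory GRing.Theory Num.Theory.
Import numFieldNormedType.Exports.

Local Open Scope classical_set_scope.
Local Open Scope complex_scope.
Local Open Scope ring_scope.

(* A complex Hilbert space: a Banach space over R[i] whose norm comes from an
   inner product, linear in the first and conjugate-linear in the second
   argument. The zero space is not excluded here. *)
HB.mixin Record isHilbert (R : realType) H of CompleteNormedModule R[i] H := {
  inner : {dot H for Num.conj} ;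
  inner_norm : forall x : H, `|x| ^+ 2 = inner x x
}.

#[short(type="hilbertType")]
HB.structure Definition Hilbert (R : realType) :=
  {H of CompleteNormedModule R[i] H & isHilbert R H}.

Section operators.
Context {R : realType} {H : hilbertType R}.
Implicit Types (A B C F : H -> H).

Local Notation "''[' u , v ]" := (@inner R H u v).

Definition bounded_operator A : Prop :=
  linear A /\ exists M : R, forall x, `|A x| <= M%:C * `|x|.

(* The norm of H takes its (real) values in R[i], hence the projection Re. *)
Definition opnorm A : R := sup [set complex.Re `|A x| | x in [set x : H | `|x| <= 1]].

Definition hermitian_operator A : Prop := forall x y, '[A x, y] = '[x, A y].

(* In R[i], 0 <= z means that z is real and nonnegative. *)
Definition positive_operator A : Prop :=
  [/\ bounded_operator A, hermitian_operator A & forall x, 0 <= '[A x, x]].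

Definition operator_le A B : Prop := positive_operator (B \- A).

Definition invertible_operator A : Prop :=
  exists2 B, bounded_operator B & cancel A B /\ cancel B A.

Definition scalar_operator (z : R[i]) : H -> H := fun x => z *: x.

Definition spectrum A : set R[i] :=
  [set z | ~ invertible_operator (A \- scalar_operator z)].

Definition poly_operator (p : {poly R}) A : H -> H :=
  fun x => \sum_(i < size p) (p`_i)%:C *: iter i A x.

(* Continuous functional calculus for a positive operator A: F = f(A) is the
   norm limit of p_n(A) for every sequence of real polynomials p_n converging
   to f uniformly on the spectrum of A. Since the spectrum is a compact subset
   of [0, +oo[, such sequences exist when f is continuous on [0, +oo[, so that
   F is then uniquely determined. *)
Definition is_functional_calculus (f : R -> R) A F : Prop :=
  bounded_operator F /\
  forall p : nat -> {poly R},
    {uniform [set t : R | spectrum A t%:C], (fun n t => (p n).[t]) @ \oo --> f} ->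
    opnorm (poly_operator (p n) A \- F) @[n --> \oo] --> (0 : R).

Lemma bounded_operator_comp A B :
  bounded_operator A -> bounded_operator B -> bounded_operator (A \o B).
Proof.
move=> [lA [M hM]] [lB [N hN]]; split.
  by move=> a x y /=; rewrite lB lA.
exists (`|M| * N) => x /=; rewrite (le_trans (hM _))//.
rewrite (@le_trans _ _ (`|M|%:C * `|B x|)) ?ler_wpM2r ?lecR ?ler_norm//.
by rewrite rmorphM -mulrA ler_wpM2l ?lecR.
Qed.

Lemma positive_scalar (t : R) : 0 <= t -> positive_operator (scalar_operator t%:C).
Proof.
move=> t0; split.
- split; first by move=> a x y; rewrite /scalar_operator scalerDr !scalerA mulrC.
  by exists t => x; rewrite normrZ ger0_norm ?lecR.
- move=> x y; rewrite /scalar_operator linearZl_LR linearZr_LR /=.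
  by congr (_ * _); rewrite conj_Creal// ger0_real ?lecR.
- by move=> x; rewrite /scalar_operator linearZl_LR /= mulr_ge0 ?lecR// dnorm_ge0.
Qed.

Lemma positive_congruence C A :
  positive_operator C -> positive_operator A -> positive_operator (C \o A \o C).
Proof.
move=> [bC hC pC] [bA hA pA]; split.
- by apply: bounded_operator_comp => //; apply: bounded_operator_comp.
- by move=> x y /=; rewrite hC hA hC.
- by move=> x /=; rewrite hC.
Qed.

End operators.

(* The positive cone B(H)^+. *)
Record posop (R : realType) (H : hilbertType R) := Posop {
  posop_fun :> H -> H ;
  posopP : positive_operator posop_fun
}.

Section connections.
Context {R : realType} {H : hilbertType R}.
Implicit Types (A B C D X : posop H) (sigma : posop H -> posop H -> posop H).

Definition posop_scalar (t : R) (t0 : 0 <= t) : posop H :=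
  Posop (positive_scalar (H := H) t0).

Definition posop_id : posop H := posop_scalar ler01.

Definition posop_congr C A : posop H :=
  Posop (positive_congruence (posopP C) (posopP A)).

Definition strictly_positive A : Prop := invertible_operator A.

Definition decreases_to (A_ : nat -> posop H) A : Prop :=
  (forall n, operator_le (A_ n.+1) (A_ n)) /\
  forall x, A_ n x @[n --> \oo] --> A x.

Definition connection sigma : Prop :=
  [/\ forall A B C D, operator_le A C -> operator_le B D ->
        operator_le (sigma A B) (sigma C D),
      forall A B C, operator_le (posop_congr C (sigma A B))
        (sigma (posop_congr C A) (posop_congr C B)) &
      forall (A_ B_ : nat -> posop H) A B,
        decreases_to A_ A -> decreases_to B_ B ->
        decreases_to (fun n => sigma (A_ n) (B_ n)) (sigma A B)].

Definition mean sigma : Prop :=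
  connection sigma /\ forall A, sigma A A = A.

End connections.

Arguments posop_id {R} H.

Section kubo_ando.
Context {R : realType}.

(* Functions [0, +oo[ -> [0, +oo[ are encoded as f : R -> R, whose values
   outside [0, +oo[ are irrelevant. *)
Definition operator_monotone (f : R -> R) : Prop :=
  [/\ forall t, 0 <= t -> 0 <= f t,
      {within `[0, +oo[, continuous f} &
      forall (K : hilbertType R) (A B fA fB : K -> K),
        positive_operator A -> positive_operator B -> operator_le A B ->
        is_functional_calculus f A fA -> is_functional_calculus f B fB ->
        operator_le fA fB].

Definition representing_function (H : hilbertType R)
    (sigma : posop H -> posop H -> posop H) (f : R -> R) : Prop :=
  operator_monotone f /\
  forall (x : R) (x0 : 0 <= x),
    scalar_operator (f x)%:C = sigma (posop_id H) (posop_scalar x0) :> (H -> H).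

(* Every connection has exactly one representing function, and this defines a
   bijection from connections onto operator monotone functions. *)
Definition kubo_ando_correspondence (H : hilbertType R) : Prop :=
  [/\ forall sigma : posop H -> posop H -> posop H, connection sigma ->
        exists2 f : R -> R, representing_function sigma f &
          forall g, representing_function sigma g ->
            forall t, 0 <= t -> g t = f t,
      forall (sigma tau : posop H -> posop H -> posop H) (f : R -> R),
        connection sigma -> connection tau ->
        representing_function sigma f -> representing_function tau f ->
        sigma = tau &
      forall f : R -> R, operator_monotone f ->
        exists2 sigma : posop H -> posop H -> posop H,
          connection sigma & representing_function sigma f].

End kubo_ando.

(* Main.v *)
Require Import Defs.
From mathcomp Require Import all_boot all_order all_algebra.
From mathcomp Require Import complex.
From mathcomp Require Import all_classical all_reals all_analysis.

(** All eleven statements are equivalent to the single condition [f 1 = 1],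
    that is, to [sigma I I = I].

    Each of them forces [f 1 = 1] by specialization to identity operators or
    to [t = 1], once the space is known to be nonzero, so that scalar operators
    determine their scalars and the identity has norm 1. On the zero space
    every operator monotone function would represent the same connection,
    which contradicts the uniqueness of representing functions
    ([kubo_ando_nontrivial]).

    Conversely, suppose that [sigma I I = I]. The usual proof that
    [sigma A A = A] is a congruence of [I] by the square root of [A]. Here the
    injectivity of the correspondence replaces it: [(A, B) |-> sigma A A] and
    [(A, B) |-> A] are both connections, and both are represented by the
    constant function 1, hence they are equal ([mean_of_unital]).

    Finally, a mean has all the other properties. Betweenness is monotonicity
    applied to [A = sigma A A <= sigma A B <= sigma B B = B] ([mean_between]);
    the inequalities on [f] are monotonicity for scalar operators; the norm
    inequalities follow since the operator norm is monotone on positive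
    operators ([opnorm_mono]); and the equations [sigma X X = A] reduce to
    [X = A]. *)

Set Implicit Arguments.
Unset Strict Implicit.
Unset Printing Implicit Defensive.

Import Order.TTheory GRing.Theory Num.Theory.
Import numFieldNormedType.Exports.

Local Open Scope classical_set_scope.
Local Open Scope complex_scope.
Local Open Scope ring_scope.

(** * Bounded linear maps *)

Section LinearMaps.
Context {R : realType} {H : hilbertType R}.
Implicit Types (A : H -> H) (x y : H).

Lemma linear_fun0 A : linear A -> A 0 = 0.
Proof.
by move=> lA; have := lA (-1) 0 0; rewrite scaler0 addr0 scaleN1r addNr.
Qed.

Lemma linear_funZ A a x : linear A -> A (a *: x) = a *: A x.
Proof. by move=> lA; rewrite -[a *: x]addr0 lA linear_fun0// addr0. Qed.

Lemma linear_funB A x y : linear A -> A (x - y) = A x - A y.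
Proof. by move=> lA; rewrite addrC -scaleN1r lA scaleN1r addrC. Qed.

Lemma linear_subfun (A B : H -> H) : linear A -> linear B -> linear (A \- B).
Proof. by move=> lA lB a x y /=; rewrite lA lB scalerBr opprD addrACA. Qed.

Lemma bounded_subfun (A B : H -> H) :
  bounded_operator A -> bounded_operator B -> bounded_operator (A \- B).
Proof.
move=> [lA [M hM]] [lB [N hN]]; split; first exact: linear_subfun.
exists (M + N) => x /=; rewrite (le_trans (ler_normB _ _))//.
by rewrite rmorphD mulrDl lerD.
Qed.

Lemma bounded_scalar (z : R[i]) : bounded_operator (scalar_operator z : H -> H).
Proof.
split; first by move=> a x y; rewrite /scalar_operator scalerDr !scalerA mulrC.
by exists (complex.Re `|z|) => x; rewrite normrZ RRe_real// ger0_real.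
Qed.

End LinearMaps.

(** * The operator norm *)

Section OperatorNorm.
Context {R : realType} {H : hilbertType R}.
Implicit Types (A : H -> H) (x : H) (M : R).

Lemma normr_RRe x : (complex.Re `|x|)%:C = `|x|.
Proof. by rewrite RRe_real// ger0_real. Qed.

Lemma opnorm_has_ubound A : bounded_operator A ->
  has_ubound [set complex.Re `|A x| | x in [set x : H | `|x| <= 1]].
Proof.
move=> [_ [M hM]]; exists `|M| => _ [x /= x1 <-].
rewrite -lecR normr_RRe (le_trans (hM x))//.
apply: (@le_trans _ _ (`|M|%:C * `|x|)); first by rewrite ler_wpM2r ?lecR ?ler_norm.
by rewrite -[leRHS]mulr1 ler_wpM2l ?lecR.
Qed.

Lemma opnorm_ge0 A : bounded_operator A -> 0 <= opnorm A.
Proof.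
move=> bA; apply: ub_le_sup; first exact: opnorm_has_ubound.
by exists 0 => /=; rewrite ?normr0 ?ler01// (linear_fun0 bA.1) normr0.
Qed.

Lemma le_opnorm A x : bounded_operator A -> `|A x| <= (opnorm A)%:C * `|x|.
Proof.
move=> bA; have [->|x0] := eqVneq x 0.
  by rewrite (linear_fun0 bA.1) !normr0 mulr0.
have nx : 0 < `|x| by rewrite normr_gt0.
rewrite -ler_pdivrMr// -(normr_id x) -normfV mulrC -normrZ -(linear_funZ _ _ bA.1).
rewrite -(normr_RRe (A _)) lecR; apply: ub_le_sup; first exact: opnorm_has_ubound.
exists (`|x|^-1 *: x) => //=.
by rewrite normrZ normfV normr_id mulVf ?normr_eq0.
Qed.

Lemma opnorm_le A M : 0 <= M -> (forall x, `|A x| <= M%:C * `|x|) ->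
  opnorm A <= M.
Proof.
move=> M0 hM; apply: ge_sup; last first.
  move=> _ [x /= x1 <-]; rewrite -lecR normr_RRe (le_trans (hM x))//.
  by rewrite -[leRHS]mulr1 ler_wpM2l ?lecR.
by exists (complex.Re `|A 0|), 0 => //=; rewrite normr0 ler01.
Qed.

Lemma opnorm_eq0 A : bounded_operator A -> opnorm A = 0 -> forall x, A x = 0.
Proof.
move=> bA A0 x; apply/eqP; rewrite -normr_le0.
by have := le_opnorm x bA; rewrite A0 mul0r.
Qed.

Lemma opnorm_scalar (z : H) M : z != 0 -> 0 <= M ->
  opnorm (scalar_operator M%:C : H -> H) = M.
Proof.
move=> z0 M0; have [bM _ _] := positive_scalar (H := H) M0.
apply/eqP; rewrite eq_le opnorm_le//=; last first.
  by move=> x; rewrite /scalar_operator normrZ ger0_norm ?lecR.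
have := le_opnorm z bM; rewrite /scalar_operator normrZ ger0_norm ?lecR//.
by rewrite ler_pM2r ?normr_gt0// lecR.
Qed.

End OperatorNorm.

(** * The order on positive operators *)

Section LoewnerOrder.
Context {R : realType} {H : hilbertType R}.
Implicit Types (A B : H -> H) (x y : H) (M : R).

Lemma inner_scaler_real x y (t : R) :
  inner x (t%:C *: y) = t%:C * inner x y.
Proof.
rewrite linearZr_LR /=; congr (_ * _).
by rewrite -[RHS]conj_Creal// complex_real.
Qed.

Lemma operator_leP A B : operator_le A B ->
  forall x, inner (A x) x <= inner (B x) x.
Proof. by move=> [_ _ p] x; have := p x; rewrite linearBl subr_ge0. Qed.

Lemma operator_le_scalar (s t : R) : s <= t ->
  operator_le (scalar_operator s%:C : H -> H) (scalar_operator t%:C).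
Proof.
move=> st; rewrite /operator_le.
have -> : scalar_operator t%:C \- scalar_operator s%:C
   = scalar_operator (t - s)%:C :> (H -> H).
  by apply/funext => x; rewrite /scalar_operator/= -scalerBl rmorphB.
by apply: positive_scalar; rewrite subr_ge0.
Qed.

Lemma scalar_operator_le (z : H) (s t : R) : z != 0 ->
  operator_le (scalar_operator s%:C : H -> H) (scalar_operator t%:C) -> s <= t.
Proof.
move=> z0 /operator_leP/(_ z); rewrite /scalar_operator !linearZl_LR /=.
by rewrite ler_pM2r ?lecR// -inner_norm exprn_gt0// normr_gt0.
Qed.

Lemma operator_lexx A : operator_le A A.
Proof.
rewrite /operator_le.
have -> : A \- A = scalar_operator (0 : R)%:C.
  by apply/funext => x; rewrite /scalar_operator /= subrr scale0r.
exact: positive_scalar.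
Qed.

(** Expanding [0 <= |A x - M x|^2] gives [2 M <A x, x> <= |A x|^2 + M^2 |x|^2],
    where [|A x|^2 <= M^2 |x|^2]. *)
Lemma inner_le_norm A M x : 0 < M -> positive_operator A ->
  `|A x| <= M%:C * `|x| -> inner (A x) x <= M%:C * `|x| ^+ 2.
Proof.
move=> M0 [_ _ pA] hM; have cM0 : 0 < M%:C by rewrite ltcR.
have innerAM : inner (A x) (M%:C *: x) = M%:C * inner (A x) x.
  by rewrite inner_scaler_real.
have := dnorm_ge0 inner (A x - M%:C *: x).
rewrite dnormB dnormZ innerAM conj_Creal; last first.
  by rewrite ger0_real// mulr_ge0// ltW.
rewrite -!inner_norm gtr0_norm// subr_ge0 => h.
have hM2 : `|A x| ^+ 2 <= M%:C ^+ 2 * `|x| ^+ 2.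
  by rewrite -exprMn lerXn2r// ?nnegrE// mulr_ge0// ltW.
have {h} := le_trans h (lerD hM2 (lexx _)).
by rewrite -!mulr2n lerMn2r/= expr2 -mulrA ler_pM2l.
Qed.

(** For positive [A] a bound on the quadratic form bounds the norm: with
    [y = x - M^-1 A x], the expansion of [0 <= <A y, y>] is
    [<A x, x> - 2 M^-1 |A x|^2 + M^-2 <A (A x), A x>], and the two outer terms
    are at most [M |x|^2] and [M^-1 |A x|^2]. *)
Lemma norm_le_inner A M x : 0 < M -> positive_operator A ->
  (forall y, inner (A y) y <= M%:C * `|y| ^+ 2) -> `|A x| <= M%:C * `|x|.
Proof.
move=> M0 [[lA _] hA pA] hM; have cM0 : 0 < M%:C by rewrite ltcR.
have iM : (M^-1)%:C = M%:C^-1 :> R[i] by rewrite fmorphV.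
have := pA (x - (M^-1)%:C *: A x).
rewrite (linear_funB _ _ lA) (linear_funZ _ _ lA).
rewrite linearBl !linearBr !linearZl_LR /= !inner_scaler_real iM.
rewrite (hA (A x) x) -inner_norm => h.
have {h} : 0 <= M%:C * `|x| ^+ 2 - M%:C^-1 * `|A x| ^+ 2.
  apply: le_trans h _; rewrite -[leRHS]subr0 lerB//.
    by rewrite lerD2r hM.
  by rewrite subr_ge0 ler_pM2l ?invr_gt0// ler_pdivrMl.
rewrite subr_ge0 ler_pdivrMl// mulrA -expr2 -exprMn.
by rewrite ler_pXn2r// nnegrE// mulr_ge0// ltW.
Qed.

(** The order compares quadratic forms, and on positive operators bounds on
    the quadratic form and on the norm are interchangeable. *)
Lemma opnorm_mono A B : positive_operator A -> positive_operator B ->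
  operator_le A B -> opnorm A <= opnorm B.
Proof.
move=> pA pB AB; have bB : bounded_operator B by case: pB.
have B0 := opnorm_ge0 bB.
(* The two conversions divide by the bound, which [e] makes positive even
   when [opnorm B = 0]. *)
apply/ler_addgt0Pr => e e0; have M0 : 0 < opnorm B + e by rewrite ltr_wpDl.
apply: opnorm_le => [|x]; first exact: ltW.
apply: norm_le_inner => // y; apply: le_trans (operator_leP AB y) _.
apply: inner_le_norm => //; apply: le_trans (le_opnorm y bB) _.
by rewrite ler_wpM2r// lecR lerDl ltW.
Qed.

End LoewnerOrder.

(** * Functional calculus of constant functions *)

Section FunctionalCalculus.
Context {R : realType} {K : hilbertType R}.
Implicit Types (A F : K -> K) (c : R).

Lemma poly_operatorC c A : poly_operator c%:P A = scalar_operator c%:C.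
Proof.
apply/funext => x; rewrite /poly_operator /scalar_operator size_polyC.
have [->|c0] := eqVneq c 0; first by rewrite big_ord0 scale0r.
by rewrite big_ord1 coefC.
Qed.

(** The constant sequence of polynomials [c] converges uniformly to [c] on any
    spectrum and its values at [A] all equal [c I], so [F] is at distance 0
    from [c I]. *)
Lemma functional_calculus_cst c A F :
  is_functional_calculus (fun=> c) A F -> F = scalar_operator c%:C.
Proof.
move=> [bF /(_ (fun=> c%:P))].
have -> : (fun (n : nat) t => c%:P.[t]) = (fun=> fun=> c).
  by apply/funext => n; apply/funext => t; rewrite hornerC.
rewrite poly_operatorC => cvgF.
have bcF : bounded_operator (scalar_operator c%:C \- F).
  exact: bounded_subfun (bounded_scalar _) bF.
have G0 : opnorm (scalar_operator c%:C \- F) = 0.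
  apply: (@cvg_unique R _ (opnorm (scalar_operator c%:C \- F) @[_ --> \oo])).
  - exact: Rhausdorff.
  - exact: cvg_cst.
  - by apply: cvgF => S /nbhs_singleton Sc; exists 0%N.
apply/funext => x; apply/esym/eqP; rewrite -subr_eq0; apply/eqP.
exact: opnorm_eq0 bcF G0 x.
Qed.

End FunctionalCalculus.

(** * Connections and the Kubo-Ando correspondence *)

Section KuboAndo.
Context {R : realType}.

Lemma operator_monotone_cst (c : R) : 0 <= c -> operator_monotone (fun=> c).
Proof.
move=> c0; split=> //; first exact/continuous_subspaceT/cst_continuous.
move=> K A B fA fB _ _ _ /functional_calculus_cst -> /functional_calculus_cst ->.
exact: operator_lexx.
Qed.

(** On the zero space the constants 0 and 1 would represent the same
    connection. *)
Lemma kubo_ando_nontrivial (H : hilbertType R) :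
  kubo_ando_correspondence H -> exists z : H, z != 0.
Proof.
move=> [KAex _ KAsurj]; apply: contrapT => /forallNP H0.
have eq0 (x : H) : x = 0 by apply/eqP; have /negP := H0 x; rewrite negbK.
have m0 := operator_monotone_cst (lexx (0 : R)).
have m1 := operator_monotone_cst (ler01 : (0 : R) <= 1).
have [tau tauC _] := KAsurj _ m0; have [g _ g_uniq] := KAex tau tauC.
have rep (h : R -> R) : operator_monotone h -> representing_function tau h.
  by move=> hm; split=> // x x0; apply/funext => y; rewrite [RHS]eq0 [LHS]eq0.
have := g_uniq _ (rep _ m0) 0 (lexx 0).
rewrite -(g_uniq _ (rep _ m1) 0 (lexx 0)) => /esym/eqP.
by rewrite oner_eq0.
Qed.

Variable H : hilbertType R.
Implicit Types (A B : posop H) (sigma : posop H -> posop H -> posop H).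

Lemma posop_inj A B : A = B :> (H -> H) -> A = B.
Proof.
case: A B => [A pA] [B pB] /= AB; rewrite AB in pA *.
by rewrite (Prop_irrelevance pA pB).
Qed.

Lemma connection_left : connection (fun A _ : posop H => A).
Proof. by split=> // A B C; exact: operator_lexx. Qed.

(** Each axiom at [(A, B)] is the axiom of [sigma] at [(A, A)]. *)
Lemma connection_diag sigma :
  connection sigma -> connection (fun A _ => sigma A A).
Proof.
move=> [M1 M2 M3]; split=> [A B C D AC _|A B C|A_ B_ A B AA _].
- exact: M1.
- exact: M2.
- exact: M3.
Qed.

(** The diagonal of [sigma], viewed as a binary operation in its first
    argument, and the left projection have the same representing function,
    the constant 1; injectivity of the correspondence identifies them. *)
Lemma mean_of_unital sigma : kubo_ando_correspondence H -> connection sigma ->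
  sigma (posop_id H) (posop_id H) = posop_id H -> mean sigma.
Proof.
move=> [_ KAinj _] sigmaC sII; split=> // A.
have m1 := operator_monotone_cst (@ler01 R).
have diag_left : (fun A _ => sigma A A) = (fun A _ : posop H => A).
  apply: (KAinj _ _ (fun=> 1) (connection_diag sigmaC) connection_left).
  - by split=> // x x0; rewrite sII.
  - by split.
exact: (congr1 (fun tau => tau A A) diag_left).
Qed.

(** [A = sigma A A <= sigma A B <= sigma B B = B]. *)
Lemma mean_between sigma A B : mean sigma -> operator_le A B ->
  operator_le A (sigma A B) /\ operator_le (sigma A B) B.
Proof.
move=> [[M1 _ _] idem] AB; split.
- by have := M1 _ _ _ _ (operator_lexx A) AB; rewrite idem.
- by have := M1 _ _ _ _ AB (operator_lexx B); rewrite idem.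
Qed.

End KuboAndo.

Theorem theorem3p1 (R : realType) (H : hilbertType R)
    (HKA : kubo_ando_correspondence H)
    (sigma : posop H -> posop H -> posop H) (sigmaC : connection sigma)
    (f : R -> R) (sigmaf : representing_function sigma f) :
  let I := posop_id H in
  [<-> mean sigma;
       forall A B : posop H, operator_le A B ->
         operator_le A (sigma A B) /\ operator_le (sigma A B) B;
       forall A : posop H, operator_le A I ->
         operator_le A (sigma A I) /\ operator_le (sigma A I) I;
       forall A : posop H, operator_le I A ->
         operator_le I (sigma I A) /\ operator_le (sigma I A) A;
       forall t : R, 0 <= t -> 1 <= t -> 1 <= f t /\ f t <= t;
       forall t : R, 0 <= t -> t <= 1 -> t <= f t /\ f t <= 1;
       forall A B : posop H, operator_le A B ->
         opnorm A <= opnorm (sigma A B) /\ opnorm (sigma A B) <= opnorm B;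
       forall A : posop H, operator_le A I ->
         opnorm A <= opnorm (sigma A I) /\ opnorm (sigma A I) <= 1;
       forall A : posop H, operator_le I A ->
         1 <= opnorm (sigma I A) /\ opnorm (sigma I A) <= opnorm A;
       sigma I I = I /\
         (forall X : posop H, strictly_positive X -> sigma X X = I -> X = I);
       forall A : posop H, strictly_positive A ->
         sigma A A = A /\
         (forall X : posop H, strictly_positive X -> sigma X X = A -> X = A)].
Proof.
move=> I.
have [z z0] := kubo_ando_nontrivial HKA.
have [[f_ge0 _ _] fE] := sigmaf.
have le_f (s t : R) : operator_le (scalar_operator s%:C : H -> H)
    (scalar_operator t%:C) -> s <= t := @scalar_operator_le _ _ z s t z0.
have II : operator_le I I := operator_lexx I.
have sIIE : sigma I I = scalar_operator (f 1)%:C :> (H -> H) by rewrite (fE _ ler01).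
have mean_of_f1 : 1 <= f 1 /\ f 1 <= 1 -> mean sigma.
  move=> [f1 f1']; apply: mean_of_unital => //; apply: posop_inj.
  by rewrite sIIE; have -> : f 1 = 1 by apply/eqP; rewrite eq_le f1'.
have mean_of_le :
    operator_le I (sigma I I) /\ operator_le (sigma I I) I -> mean sigma.
  by rewrite sIIE => -[h1 h2]; apply: mean_of_f1; split; apply: le_f.
have opnormI : opnorm I = 1 := opnorm_scalar z0 ler01.
have mean_of_opnorm :
    1 <= opnorm (sigma I I) /\ opnorm (sigma I I) <= 1 -> mean sigma.
  by rewrite sIIE (opnorm_scalar z0) ?f_ge0.
have mean_opnorm_between (A B : posop H) : mean sigma -> operator_le A B ->
    opnorm A <= opnorm (sigma A B) /\ opnorm (sigma A B) <= opnorm B.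
  move=> sigmaM AB; have [h1 h2] := mean_between sigmaM AB.
  by split; apply: opnorm_mono => //; exact: posopP.
tfae.
- by move=> sigmaM A B; exact: mean_between.
- by move=> between A; exact: between.
- by move=> /(_ I II)/mean_of_le sigmaM A; exact: mean_between.
- move=> between t t0 t1.
  have [] := between (posop_scalar t0) (operator_le_scalar t1).
  by rewrite -fE => h1 h2; split; apply: le_f.
- move=> /(_ 1 ler01 (lexx 1))/mean_of_f1[[M1 _ _] idem] t t0 t1.
  have tI : operator_le (posop_scalar (H := H) t0) I := operator_le_scalar t1.
  (* The smaller operator is on the right here, so betweenness does not apply,
     but [tI = sigma tI tI <= sigma I tI <= sigma I I = I]. *)
  split; apply: le_f; rewrite fE.
    by have := M1 _ _ _ _ tI (operator_lexx (posop_scalar t0)); rewrite idem.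
  by have := M1 _ _ _ _ II tI; rewrite idem.
- by move=> /(_ 1 ler01 (lexx 1))/mean_of_f1 sigmaM A B; exact: mean_opnorm_between.
- by move=> opnorm_between A AI; rewrite -opnormI; exact: opnorm_between.
- move=> /(_ I II); rewrite opnormI => /mean_of_opnorm sigmaM A IA.
  by rewrite -opnormI; exact: mean_opnorm_between.
- move=> /(_ I II); rewrite opnormI => /mean_of_opnorm[_ idem].
  by split=> // X _; rewrite idem.
- move=> [sII _] A _; have [_ idem] := mean_of_unital HKA sigmaC sII.
  by split=> // X _; rewrite idem.
- move=> strict; apply: mean_of_unital => //; apply: (strict I _).1.
  have [bI _ _] := posopP I; exists I => //.
  by split=> x; rewrite /= /scalar_operator !scale1r.
Qed.
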